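(* Let $\mathcal{I}$ be a non-empty collection of locally compact metric spaces, and let $I\mapsto (C(I),\alpha_I)$ be a functorial assignment of a locally compact metric space $C(I)$ and a dense isometric embedding $\alpha_I: I\to C(I)$ to each $I\in\mathcal{I}$. Then the assignment $F_D:\mathbf{DBunC^*Alg}_{\mathcal{I}}\to\mathbf{DBunC^*Alg}_{C(\mathcal{I})}$ given on objects by $(\mathcal{A}_I,(\tau^{\mathcal{A}}_t)_{t\in\mathbb{R}})\mapsto(F(\mathcal{A}_I),(\tau^{\mathcal{A}}_t)_{t\in\mathbb{R}})$ and on morphisms by $\sigma\mapsto F(\sigma)$ is a functor.
   Context: For a metric space $I$, $UC_b(I)$ is the C*-algebra of bounded uniformly continuous functions $I\to\mathbb{C}$. C*-algebras are not assumed unital. A $UC_b$ bundle of C*-algebras over a metric space $I$, written $((\mathfrak{A}_\hbar,\phi^I_\hbar)_{\hbar\in I},\mathfrak{A})$, is a family of C*-algebras $(\mathfrak{A}_\hbar)_{\hbar\in I}$, a C*-algebra $\mathfrak{A}$, and *-homomorphisms $\phi^I_\hbar:\mathfrak{A}\to\mathfrak{A}_\hbar$ such that: (i) each $\phi^I_\hbar$ is surjective and $\|a\|=\sup_{\hbar\in I}\|\phi^I_\hbar(a)\|_\hbar$ for all $a\in\mathfrak{A}$; (ii) for each $f\in UC_b(I)$ and $a\in\mathfrak{A}$ there is an element $fa\in\mathfrak{A}$ with $\phi^I_\hbar(fa)=f(\hbar)\phi^I_\hbar(a)$ for all $\hbar\in I$; (iii) for each $a\in\mathfrak{A}$, the function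 $\hbar\mapsto\|\phi^I_\hbar(a)\|_\hbar$ is in $UC_b(I)$. A homomorphism from $\mathcal{A}_I=((\mathfrak{A}_\hbar,\phi^I_\hbar)_{\hbar\in I},\mathfrak{A})$ to $\mathcal{B}_J=((\mathfrak{B}_\hbar,\phi^J_\hbar)_{\hbar\in J},\mathfrak{B})$ is a pair $\sigma=(\alpha,\beta)$ where $\alpha:I\to J$ is a metric map (i.e. $d_J(\alpha(x),\alpha(y))\le d_I(x,y)$), $\beta:\mathfrak{A}\to\mathfrak{B}$ is a *-homomorphism, and for all $a_1,a_2\in\mathfrak{A}$, $\hbar\in I$: if $\phi^I_\hbar(a_1)=\phi^I_\hbar(a_2)$, then $\phi^J_{\alpha(\hbar)}(\beta(a_1))=\phi^J_{\alpha(\hbar)}(\beta(a_2))$. Composition is componentwise. A map is proper if preimages of compact sets are compact. A dense isometric embedding is an isometry onto its image whose image is dense. The assignment $I\mapsto(C(I),\alpha_I)$ is functorial if: (i) for each proper metric map $f:I\to J$ with $I,J\in\mathcal{I}$ there is a (continuous) map $C(f):C(I)\to C(J)$ with $C(f)\circ\alpha_I=\alpha_J\circ f$; (ii) $C(g\circ f)=C(g)\circ C(f)$ for proper metric maps $f:I\to J$, $g:J\to K$. Put $C(\mathcal{I})=\{C(I):I\in\mathcal{I}\}$. A dynamical bundle of C*-algebras over $I$ is a $UC_b$ bundle $\mathcal{A}_I=((\mathfrak{A}_\hbar,\phi^I_\hbar)_{\hbar\in I},\mathfrak{A})$ together with a one-parameter group of automorphisms $(\tau^{\mathcal{A}}_t)_{t\in\mathbb{R}}$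 of $\mathfrak{A}$ such that for all $\hbar\in I$, $t\in\mathbb{R}$ there is an automorphism $\tau^{\mathcal{A}}_{t;\hbar}$ of $\mathfrak{A}_\hbar$ with $\tau^{\mathcal{A}}_{t;\hbar}\circ\phi^I_\hbar=\phi^I_\hbar\circ\tau^{\mathcal{A}}_t$. The category $\mathbf{DBunC^*Alg}_{\mathcal{I}}$ has as objects the dynamical bundles with $I\in\mathcal{I}$ and as morphisms the homomorphisms $\sigma=(\alpha,\beta):\mathcal{A}_I\to\mathcal{B}_J$ of $UC_b$ bundles with $\alpha$ proper and $\tau^{\mathcal{B}}_t\circ\beta=\beta\circ\tau^{\mathcal{A}}_t$ for all $t\in\mathbb{R}$. $\mathbf{DBunC^*Alg}_{C(\mathcal{I})}$ is defined in the same way with base spaces in $C(\mathcal{I})$. $F$ is defined by $F(\mathcal{A}_I)=\tilde{\mathcal{A}}_{C(I)}$ and $F(\alpha,\beta)=(C(\alpha),\beta)$. Here $\tilde{\mathcal{A}}_{C(I)}=((\mathfrak{A}/\mathcal{K}_j,\phi^{C(I)}_j)_{j\in C(I)},\mathfrak{A})$ is the minimal extension of $\mathcal{A}_I$ associated with $\alpha_I$ (unique up to isomorphism): $\mathcal{K}_j$ is the closed two-sided ideal of all $a\in\mathfrak{A}$ such that $\lim_\delta\|\phi^I_{i_\delta}(a)\|_{i_\delta}=0$ for every net $\{i_\delta\}$ in $I$ with $\alpha_I(i_\delta)\to j$, and $\phi^{C(I)}_j$ is the quotient map; its algebra of sections is the same $\mathfrak{A}$.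
   Formalization: It is additionally assumed that C(f) is proper for every proper metric map f between spaces of the collection; without this the claim fails, e.g. f(x)=1/x from I=[1,∞)=C(I) to J=(0,1] with C(J)=[0,1], where C(f) is not proper. *)

(* Defs.v *)
From HB Require Import structures.
From mathcomp Require Import all_boot all_order all_algebra.
From mathcomp Require Import generic_quotient ring_quotient.
From mathcomp Require Import all_classical all_reals all_analysis.
From mathcomp Require Import complex.
From mathcomp Require Import ring lra.

Set Implicit Arguments.
Unset Strict Implicit.
Unset Printing Implicit Defensive.

Import Order.TTheory GRing.Theory Num.Theory.
Import numFieldNormedType.Exports.

Local Open Scope classical_set_scope.
Local Open Scope ring_scope.

(* MathComp rings are unital, so the multiplication of a (not necessarily
   unital) C*-algebra is carried by the mixin. *)
HB.mixin Record CompleteNormedModule_isCStarAlgebra (R : realType) A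
    & CompleteNormedModule R[i] A := {
  cmul : A -> A -> A;
  cstar : A -> A;
  cmulA : associative cmul;
  cmulDl : forall x y z, cmul (x + y) z = cmul x z + cmul y z;
  cmulDr : forall x y z, cmul x (y + z) = cmul x y + cmul x z;
  cmulZl : forall (c : R[i]) x y, cmul (c *: x) y = c *: cmul x y;
  cmulZr : forall (c : R[i]) x y, cmul x (c *: y) = c *: cmul x y;
  cnormM : forall x y, `|cmul x y| <= `|x| * `|y|;
  cstarK : involutive cstar;
  cstarD : forall x y, cstar (x + y) = cstar x + cstar y;
  cstarZ : forall (c : R[i]) x, cstar (c *: x) = conjc c *: cstar x;
  cstarM : forall x y, cstar (cmul x y) = cmul (cstar y) (cstar x);
  cnorm_star : forall x, `|cmul (cstar x) x| = `|x| ^+ 2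
}.

#[short(type="cstarAlgType")]
HB.structure Definition CStarAlgebra (R : realType) :=
  {A of CompleteNormedModule R[i] A
      & CompleteNormedModule_isCStarAlgebra R A}.

(* The norm of a C*-algebra takes its values in the nonnegative reals of R[i];
   rnorm is the same norm with values in R. *)
Definition rnorm (R : realType) (A : cstarAlgType R) (a : A) : R :=
  complex.Re `|a|.

Definition star_hom (R : realType) (A B : cstarAlgType R) (f : A -> B) :=
  [/\ linear f,
      forall x y, f (cmul x y) = cmul (f x) (f y) &
      forall x, f (cstar x) = cstar (f x)].

Definition star_aut (R : realType) (A : cstarAlgType R) (f : A -> A) :=
  star_hom f /\ bijective f.

Definition UCb (R : realType) (I : metricType R) : set (I -> R[i]^o) :=
  [set f | unif_continuous f /\ bounded_fun f].

(* rnorm_sup uses sup set0 = 0, the supremum in [0, +oo[ of the empty family,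
   when I is empty. The suprema are finite by ucb_norm. *)
Record ucbBundle (R : realType) (I : metricType R) := UCbBundle {
  fibre : I -> cstarAlgType R;
  sections : cstarAlgType R;
  ev : forall h : I, sections -> fibre h;
  ev_star_hom : forall h, star_hom (ev h);
  ev_surj : forall h (y : fibre h), exists a, ev h a = y;
  rnorm_sup : forall a, rnorm a = sup [set rnorm (ev h a) | h in [set: I]];
  ucb_mul : forall (f : I -> R[i]^o) (a : sections), UCb f ->
    exists fa, forall h, ev h fa = f h *: ev h a;
  ucb_norm : forall a, UCb (fun h => `|ev h a|) }.

Definition metric_map (R : realType) (I J : metricType R) (f : I -> J) :=
  forall x y, mdist (f x) (f y) <= mdist x y.

Definition proper_map (S T : topologicalType) (f : S -> T) :=
  forall K, compact K -> compact (f @^-1` K).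

Definition dense_isometric_embedding (R : realType) (I J : metricType R)
    (f : I -> J) :=
  (forall x y, mdist (f x) (f y) = mdist x y) /\ dense (range f).

(* Nets: a family indexed by a nonempty directed preorder, converging along
   the filter generated by the tails of the index set. *)
Definition directed (D : Type) (le : D -> D -> Prop) :=
  [/\ [set: D] !=set0,
      forall a, le a a,
      forall b a c, le a b -> le b c -> le a c &
      forall a b, exists c, le a c /\ le b c].

Definition tails (D : Type) (le : D -> D -> Prop) : set_system D :=
  filter_from [set: D] (fun d => [set e | le d e]).

Section MinimalExtension.
Context (R : realType) (I J : metricType R) (A : ucbBundle I) (al : I -> J).

Definition extension_ideal (j : J) : set (sections A) :=
  [set a | forall (D : Type) (le : D -> D -> Prop) (i : D -> I),
      directed le ->
      al (i d) @[d --> tails le] --> j ->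
      rnorm (ev (i d) a) @[d --> tails le] --> (0 : R)].

End MinimalExtension.

Arguments extension_ideal {R I J} A al j.

Section RealNorm.
Context (R : realType) (A : cstarAlgType R).
Implicit Types a b : A.

Lemma rnormE a : `|a| = (rnorm a)%:C%C.
Proof. by rewrite /rnorm RRe_real// ger0_real. Qed.

Lemma rnorm_ge0 a : 0 <= rnorm a.
Proof. by rewrite -ler0c -rnormE. Qed.

Lemma rnormD a b : rnorm (a + b) <= rnorm a + rnorm b.
Proof. by rewrite -lecR rmorphD/= -!rnormE ler_normD. Qed.

Lemma rnormN a : rnorm (- a) = rnorm a.
Proof. by rewrite /rnorm normrN. Qed.

Lemma rnormB a b : `|rnorm a - rnorm b| <= rnorm (a - b).
Proof.
rewrite ler_norml; apply/andP; split.
  have := rnormD (b - a) a; rewrite subrK -(rnormN (b - a)) opprB; lra.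
by have := rnormD (a - b) b; rewrite subrK; lra.
Qed.

Lemma rnormZ (c : R[i]) a : rnorm (c *: a) = complex.Re `|c| * rnorm a.
Proof.
apply: (@complexI R); rewrite -rnormE normrZ rnormE rmorphM/=.
by rewrite RRe_real// ger0_real.
Qed.

Lemma rnormM a b : rnorm (cmul a b) <= rnorm a * rnorm b.
Proof. by rewrite -lecR rmorphM/= -!rnormE cnormM. Qed.

Lemma rnorm_cstar a : rnorm (cmul (cstar a) a) = rnorm a ^+ 2.
Proof. by apply: (@complexI R); rewrite -rnormE cnorm_star rnormE rmorphXn. Qed.

Lemma rnorm_star a : rnorm (cstar a) = rnorm a.
Proof.
have le (x : A) : rnorm x <= rnorm (cstar x).
  have [->|x0] := eqVneq (rnorm x) 0; first exact: rnorm_ge0.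
  have xp : 0 < rnorm x by rewrite lt_neqAle eq_sym x0 rnorm_ge0.
  by rewrite -(ler_pM2r xp) -expr2 -rnorm_cstar rnormM.
by apply/eqP; rewrite eq_le -{2}(cstarK a) !le.
Qed.

Lemma rnorm0 : rnorm (0 : A) = 0.
Proof. by rewrite /rnorm normr0. Qed.

Lemma rnorm_eq0 a : rnorm a = 0 -> a = 0.
Proof. by move=> a0; apply: normr0_eq0; rewrite rnormE a0. Qed.

End RealNorm.

Section StarHom.
Context (R : realType) (A B : cstarAlgType R) (f : A -> B).
Hypothesis fh : star_hom f.

Lemma star_homD a b : f (a + b) = f a + f b.
Proof. by case: fh => lf _ _; have := lf 1 a b; rewrite scale1r => ->; rewrite scale1r. Qed.

Lemma star_hom0 : f 0 = 0.
Proof. by have := star_homD 0 0; rewrite addr0 => /eqP; rewrite -subr_eq subrr => /eqP. Qed.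

Lemma star_homZ c a : f (c *: a) = c *: f a.
Proof. by case: fh => lf _ _; have := lf c a 0; rewrite star_hom0 addr0 => ->; rewrite addr0. Qed.

Lemma star_homN a : f (- a) = - f a.
Proof. by rewrite -scaleN1r star_homZ scaleN1r. Qed.

Lemma star_homB a b : f (a - b) = f a - f b.
Proof. by rewrite star_homD star_homN. Qed.

Lemma star_homM a b : f (cmul a b) = cmul (f a) (f b).
Proof. by case: fh. Qed.

Lemma star_homS a : f (cstar a) = cstar (f a).
Proof. by case: fh. Qed.

End StarHom.

Lemma cmul0x (R : realType) (A : cstarAlgType R) (a : A) : cmul 0 a = 0.
Proof. by have := cmulZl 0 0 a; rewrite !scale0r. Qed.

Lemma cmulx0 (R : realType) (A : cstarAlgType R) (a : A) : cmul a 0 = 0.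
Proof. by have := cmulZr 0 a 0; rewrite !scale0r. Qed.

Lemma cmulBl (R : realType) (A : cstarAlgType R) (a b c : A) :
  cmul (a - b) c = cmul a c - cmul b c.
Proof. by rewrite cmulDl -scaleN1r cmulZl scaleN1r. Qed.

Lemma cmulBr (R : realType) (A : cstarAlgType R) (a b c : A) :
  cmul a (b - c) = cmul a b - cmul a c.
Proof. by rewrite cmulDr -scaleN1r cmulZr scaleN1r. Qed.

Lemma cstar0 (R : realType) (A : cstarAlgType R) : cstar (0 : A) = 0.
Proof.
by have := cstarD (0 : A) 0; rewrite addr0 => /eqP; rewrite -subr_eq subrr => /eqP.
Qed.

Lemma cstarB (R : realType) (A : cstarAlgType R) (a b : A) :
  cstar (a - b) = cstar a - cstar b.
Proof. by rewrite cstarD -(scaleN1r b) cstarZ rmorphN1 scaleN1r. Qed.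

Section UniformlyContinuous.
Context (R : realType) (I : metricType R).

Lemma UCb_realP (g : I -> R) : UCb (fun i => (g i)%:C%C) <->
  (forall e, 0 < e -> exists2 d, 0 < d &
     forall x y, mdist x y < d -> `|g x - g y| < e) /\
  (exists M, forall x, `|g x| <= M).
Proof.
have normC (r : R) : `|r%:C%C : R[i]^o| = (`|r|)%:C%C.
  by rewrite normc_def/= expr0n addr0 sqrtr_sqr.
split=> [[guc [M [Mr gM]]]|[guc [M gM]]].
  split=> [e e0|].
    have /guc : entourage [set xy : R[i]^o * R[i]^o | ball xy.1 e%:C%C xy.2].
      by rewrite -entourage_ballE; exists e%:C%C => //=; rewrite ltcR.
    rewrite /nbhs/= -entourage_ballE => -[d /= d0 dg]; exists d => // x y xy.
    have /dg/= : [set xy : I * I | ball xy.1 d xy.2] (x, y).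
      by rewrite /= ballEmdist.
    by rewrite /ball/= -rmorphB/= normC ltcR.
  exists (complex.Re (M + 1)) => x.
  have /(_ x Logic.I) := gM (M + 1) (ltr_pwDr ltr01 (lexx _)).
  by rewrite /= normC lecE => /andP[_].

split.
  rewrite /unif_continuous => E.
  rewrite -entourage_ballE => -[e /= e0 eE].
  have er : 0 < complex.Re e by move: e0; rewrite ltcE => /andP[_].
  have ee : e = (complex.Re e)%:C%C by rewrite RRe_real// gtr0_real.
  have [d d0 dg] := guc _ er.
  rewrite /nbhs/= -entourage_ballE; exists d => //= -[x y]/=.
  rewrite ballEmdist/= => xy; apply: eE => /=.
  by rewrite /ball/= -rmorphB/= normC ee ltcR dg.
exists M%:C%C; split; first by apply/complex_realP; exists M.
move=> c Mc x _; rewrite /= normC; apply: le_trans (ltW Mc).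
by rewrite lecR.
Qed.

End UniformlyContinuous.

Lemma tails_filter (D : Type) (le : D -> D -> Prop) :
  directed le -> ProperFilter (tails le).
Proof.
move=> [[d0 _] lexx letr ledir]; apply: filter_from_proper.
  apply: filter_from_filter; first by exists d0.
  move=> a b _ _; have [c [ac bc]] := ledir a b; exists c => // e /= ce.
  by split; [exact: letr ac ce|exact: letr bc ce].
by move=> d _; exists d; exact: lexx.
Qed.

Section Bundle.
Context (R : realType) (I : metricType R) (A : ucbBundle I).
Implicit Types a b : sections A.

Definition fnorm a (i : I) : R := rnorm (ev i a).

Lemma fnorm_ucb a :
  (forall e, 0 < e -> exists2 d, 0 < d &
     forall x y, mdist x y < d -> `|fnorm a x - fnorm a y| < e) /\
  (exists M, forall x, `|fnorm a x| <= M).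
Proof.
apply/UCb_realP; have := ucb_norm a; congr (UCb _).
by apply/funext => i; rewrite rnormE.
Qed.

Lemma fnorm_le a i : fnorm a i <= rnorm a.
Proof.
rewrite rnorm_sup; apply: ub_le_sup; last by exists i.
have [_ [M aM]] := fnorm_ucb a; exists M => _ [h _ <-].
by rewrite (le_trans (ler_norm _))// aM.
Qed.

Lemma rnorm_le a (M : R) : 0 <= M -> (forall i, fnorm a i <= M) -> rnorm a <= M.
Proof.
move=> M0 aM; rewrite rnorm_sup.
have [S0|/set0P S0] := eqVneq [set rnorm (ev h a) | h in [set: I]] set0.
  by rewrite S0 sup0.
by apply: ge_sup => // _ [h _ <-]; exact: aM.
Qed.

Lemma fnorm_ge0 a i : 0 <= fnorm a i. Proof. exact: rnorm_ge0. Qed.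

Lemma fnormD a b i : fnorm (a + b) i <= fnorm a i + fnorm b i.
Proof. by rewrite /fnorm (star_homD (ev_star_hom A i)) rnormD. Qed.

Lemma fnormB a b i : `|fnorm a i - fnorm b i| <= fnorm (a - b) i.
Proof. by rewrite /fnorm (star_homB (ev_star_hom A i)) rnormB. Qed.

Lemma fnormN a i : fnorm (- a) i = fnorm a i.
Proof. by rewrite /fnorm (star_homN (ev_star_hom A i)) rnormN. Qed.

Lemma fnormZ c a i : fnorm (c *: a) i = complex.Re `|c| * fnorm a i.
Proof. by rewrite /fnorm (star_homZ (ev_star_hom A i)) rnormZ. Qed.

Lemma fnormM a b i : fnorm (cmul a b) i <= fnorm a i * fnorm b i.
Proof. by rewrite /fnorm (star_homM (ev_star_hom A i)) rnormM. Qed.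

Lemma fnormS a i : fnorm (cstar a) i = fnorm a i.
Proof. by rewrite /fnorm (star_homS (ev_star_hom A i)) rnorm_star. Qed.

Lemma fnormSM a i : fnorm (cmul (cstar a) a) i = fnorm a i ^+ 2.
Proof.
rewrite /fnorm (star_homM (ev_star_hom A i)) (star_homS (ev_star_hom A i)).
exact: rnorm_cstar.
Qed.

Lemma fnorm0 i : fnorm 0 i = 0.
Proof. by rewrite /fnorm (star_hom0 (ev_star_hom A i)) rnorm0. Qed.

Section Ideal.
Context (J : metricType R) (al : I -> J) (j : J).
Hypothesis hal : dense_isometric_embedding al.

Definition near_pt : set_system I :=
  filter_from [set e : R | 0 < e] (fun e => [set i | mdist j (al i) < e]).

#[local] Instance near_pt_filter : ProperFilter near_pt.
Proof.
apply: filter_from_proper.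
  apply: filter_from_filter; first by exists 1 => /=.
  move=> a b a0 b0; exists (Num.min a b) => /=; first by rewrite lt_min a0.
  by move=> i /=; rewrite lt_min => /andP[].
move=> e e0.
have [|x [/interior_subset jx [i _ ix]]] := hal.2 (ball j e)^° _ (@open_interior _ _).
  by exists j; apply: nbhs_singleton; apply: nbhs_interior; exact: nbhsx_ballx.
by exists i => /=; move: jx; rewrite -ix ballEmdist.
Qed.

Lemma extension_ideal_cvg a : extension_ideal A al j a <->
  fnorm a i @[i --> near_pt] --> (0 : R).
Proof.
split=> [Ka|Ka D le i dle].
  apply: contrapT => /cvgr0Pnorm_lt/existsNP[e /not_implyP[e0 nE]].
  have {}nE (m : nat) : exists i, mdist j (al i) < m.+1%:R^-1 /\ e <= fnorm a i.
    apply: contrapT => ne; apply: nE; exists m.+1%:R^-1 => //= i ji.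
    rewrite ger0_norm ?fnorm_ge0// ltNge; apply/negP => ei.
    by apply: ne; exists i.
  have [s sP] := choice nE.
  have dn : @directed nat (fun p q => (p <= q)%N).
    split=> [|p|q p r|]; [by exists 0%N|exact: leqnn|exact: leq_trans|].
    by move=> p q; exists (maxn p q); rewrite leq_maxl leq_maxr.
  have tf := tails_filter dn.
  have sj : al (s d) @[d --> tails (fun p q => (p <= q)%N)] --> j.
    apply/cvg_ballP => r r0.
    have [m mr] : exists m, m.+1%:R^-1 < r.
      exists (Num.truncn r^-1); rewrite invf_plt ?posrE//.
      exact: truncnS_gt.
    exists m => // p /= mp; rewrite ballEmdist /=.
    apply: lt_trans mr; apply: lt_le_trans (sP p).1 _.
    by rewrite lef_pV2 ?posrE// ler_nat.
  have /cvgr0Pnorm_lt/(_ _ e0)[m _ /(_ m)] /= := Ka _ _ s dn sj.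
  by move=> /(_ (leqnn _)); rewrite ger0_norm ?fnorm_ge0// ltNge (sP m).2.
have tf := tails_filter dle.
move=> ij; apply: (@cvg_comp _ _ _ i (fnorm a) _ near_pt) => //.
move=> S [e e0 eS]; have /cvg_ballP/(_ _ e0)[d _ dS] := ij.
by exists d => // d' /dS; rewrite ballEmdist => /eS.
Qed.

End Ideal.
End Bundle.

Section IdealTheory.
Context (R : realType) (I J : metricType R) (A : ucbBundle I) (al : I -> J).
Hypothesis hal : dense_isometric_embedding al.
Variable j : J.
Implicit Types a b : sections A.

Local Notation G := (near_pt al j).
Local Notation K := (extension_ideal A al j).
Let GF : ProperFilter G := near_pt_filter j hal.
#[local] Existing Instance GF.

Let KP a : K a <-> fnorm a i @[i --> G] --> (0 : R).
Proof. exact: extension_ideal_cvg. Qed.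

Lemma fnorm_bounded a : exists2 M, 0 < M & forall i, fnorm a i <= M.
Proof.
exists (rnorm a + 1) => [|i]; first by rewrite ltr_pwDr// rnorm_ge0.
by rewrite ler_wpDr// fnorm_le.
Qed.

Lemma ideal_sub a b c : K a -> K b -> (forall i, fnorm c i <= fnorm a i + fnorm b i) -> K c.
Proof.
move=> /KP Ka /KP Kb cab; apply/KP.
apply: (@squeeze_cvgr _ _ _ _ (cst 0) (fun i => fnorm a i + fnorm b i)).
- by apply: nearW => i; rewrite fnorm_ge0 cab.
- exact: cvg_cst.
- by rewrite -[0](addr0 0); exact: cvgD.
Qed.

Lemma ideal_le a c M : K a -> (forall i, fnorm c i <= M * fnorm a i) -> K c.
Proof.
move=> /KP Ka ca; apply/KP.
apply: (@squeeze_cvgr _ _ _ _ (cst 0) (fun i => M * fnorm a i)).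
- by apply: nearW => i; rewrite fnorm_ge0 ca.
- exact: cvg_cst.
- by rewrite -[0](mulr0 M); apply: cvgM => //; exact: cvg_cst.
Qed.

Lemma ideal0 : K 0.
Proof.
by apply/KP; rewrite (_ : fnorm 0 = cst 0); [exact: cvg_cst|apply/funext => i; exact: fnorm0].
Qed.

Lemma idealB a b : K a -> K b -> K (a - b).
Proof.
by move=> Ka Kb; apply: (ideal_sub Ka Kb) => i; rewrite -(fnormN b) fnormD.
Qed.

Lemma idealZ c a : K a -> K (c *: a).
Proof. by move=> Ka; apply: (ideal_le (M := complex.Re `|c|) Ka) => i; rewrite fnormZ. Qed.

Lemma idealS a : K a -> K (cstar a).
Proof. by move=> Ka; apply: (ideal_le (M := 1) Ka) => i; rewrite fnormS mul1r. Qed.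

Lemma idealMl a b : K a -> K (cmul b a).
Proof.
move=> Ka; apply: (ideal_le (M := rnorm b) Ka) => i.
by rewrite (le_trans (fnormM _ _ _))// ler_wpM2r ?fnorm_ge0 ?fnorm_le.
Qed.

Lemma idealMr a b : K a -> K (cmul a b).
Proof.
move=> Ka; apply: (ideal_le (M := rnorm b) Ka) => i.
by rewrite (le_trans (fnormM _ _ _))// mulrC ler_wpM2r ?fnorm_ge0 ?fnorm_le.
Qed.

Lemma mdist_al_le x y : mdist j (al x) <= mdist x y + mdist j (al y).
Proof. by rewrite -hal.1 addrC (metric_sym (al x)) metric_triangle. Qed.

Definition bump (r : R) (i : I) : R := Num.max 0 (1 - mdist j (al i) / r).

Lemma bump01 r i : 0 < r -> 0 <= bump r i <= 1.
Proof.
move=> r0; rewrite /bump le_max lexx/= ge_max ler01/= gerBl.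
by rewrite divr_ge0 ?mdist_ge0// ltW.
Qed.

Lemma bump_out r i : 0 < r -> r <= mdist j (al i) -> bump r i = 0.
Proof.
by move=> r0 ri; rewrite /bump max_l// subr_le0 ler_pdivlMr// mul1r.
Qed.

Lemma bump_lip r x y : 0 < r -> `|bump r x - bump r y| <= mdist x y / r.
Proof.
move=> r0; have le u v : bump r u - bump r v <= mdist u v / r.
  have uv : mdist j (al v) <= mdist u v + mdist j (al u).
    by rewrite (metric_sym u) mdist_al_le.
  have : mdist j (al v) / r <= mdist u v / r + mdist j (al u) / r.
    by rewrite -mulrDl ler_pM2r// invr_gt0.
  have := bump01 v r0; have : 0 <= mdist u v / r.
    by rewrite divr_ge0 ?mdist_ge0// ltW.
  rewrite {2}/bump => ? /andP[? _] ?.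
  rewrite lerBlDr /bump ge_max; apply/andP; split; first by rewrite addr_ge0.
  have : 1 - mdist j (al v) / r <= bump r v by rewrite /bump le_max lexx orbT.
  by rewrite /bump; lra.
rewrite ler_norml le andbT; have := le y x; rewrite metric_sym; lra.
Qed.

Lemma bump_ucb r : 0 < r -> UCb (fun i => (bump r i)%:C%C).
Proof.
move=> r0; apply/UCb_realP; split=> [e e0|].
  exists (e * r) => [|x y xy]; first by rewrite mulr_gt0.
  by rewrite (le_lt_trans (bump_lip x y r0))// ltr_pdivrMr.
by exists 1 => x; have /andP[? ?] := bump01 x r0; rewrite ger0_norm.
Qed.

Lemma bump_cvg r : 0 < r -> bump r i @[i --> G] --> (1 : R).
Proof.
move=> r0; apply/cvgrPdist_lt => e e0.
exists (e * r) => [|i /= ji]; first by rewrite /= mulr_gt0.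
have /andP[_ b1] := bump01 i r0.
rewrite ger0_norm ?subr_ge0//.
have : 1 - mdist j (al i) / r <= bump r i by rewrite /bump le_max lexx orbT.
have : mdist j (al i) / r < e by rewrite ltr_pdivrMr.
by lra.
Qed.

(* cutting a section off near j does not change its class modulo the ideal *)
Lemma bump_mul r a : 0 < r -> exists2 b, K (b - a) &
  forall i, fnorm b i = bump r i * fnorm a i.
Proof.
move=> r0; have [b bE] := ucb_mul a (bump_ucb r0).
exists b => [|i]; last first.
  rewrite /fnorm bE rnormZ; congr (_ * _).
  have /andP[b0 _] := bump01 i r0.
  by rewrite ger0_norm ?ler0c.
have [M M0 aM] := fnorm_bounded a.
apply/KP; apply: (@squeeze_cvgr _ _ _ _ (cst 0) (fun i => (1 - bump r i) * M)).
- apply: nearW => i; rewrite fnorm_ge0/= /fnorm (star_homB (ev_star_hom A i)) bE.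
  rewrite -[X in _ - X]scale1r -scalerBl rnormZ.
  have /andP[b0 b1] := bump01 i r0.
  have -> : complex.Re `|(bump r i)%:C%C - 1| = 1 - bump r i.
    rewrite -(rmorph1 (real_complex R)) -rmorphB/=.
    by rewrite expr0n addr0 sqrtr_sqr distrC ger0_norm ?subr_ge0.
  by rewrite ler_wpM2l ?subr_ge0// aM.
- exact: cvg_cst.
- have -> : (0 : R) = (1 - 1) * M by rewrite subrr mul0r.
  by apply: cvgM; [apply: cvgB; [exact: cvg_cst|exact: bump_cvg]|exact: cvg_cst].
Qed.

(* the norm of the class of a in the quotient by the ideal, see quot_normE *)
Definition cnrm a : R := inf [set rnorm b | b in [set b | K (b - a)]].

Lemma cnrm_inf a : has_inf [set rnorm b | b in [set b | K (b - a)]].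
Proof.
split; first by exists (rnorm a), a => //=; rewrite subrr; exact: ideal0.
by exists 0 => _ [b _ <-]; exact: rnorm_ge0.
Qed.

Lemma fnorm_cvg a : fnorm a i @[i --> G] --> cnrm a.
Proof.
apply/cvgrPdist_le => e e0.
have [/(_ _ e0)[d d0 ad] _] := fnorm_ucb a.
have d20 : 0 < d / 2 by rewrite divr_gt0.
exists (d / 2) => //= i ji; rewrite distrC ler_norml; apply/andP; split.
  have [b Kb bE] := bump_mul a d20.
  have : cnrm a <= rnorm b by apply: ge_inf; [case: (cnrm_inf a)|exists b].
  suff : rnorm b <= fnorm a i + e by lra.
  apply: rnorm_le => [|i']; first by rewrite addr_ge0 ?fnorm_ge0// ltW.
  rewrite bE; have /andP[b0 b1] := bump01 i' d20.
  have [ji'|ji'] := ltP (mdist j (al i')) (d / 2); last first.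
    by rewrite bump_out// mul0r addr_ge0 ?fnorm_ge0// ltW.
  have /ad : mdist i' i < d.
    rewrite -hal.1 (le_lt_trans (metric_triangle _ j _))// (splitr d).
    by rewrite ltrD// metric_sym.
  have := fnorm_ge0 a i'; rewrite ltr_norml => a0 /andP[_].
  have : bump (d / 2) i' * fnorm a i' <= fnorm a i' by rewrite ler_piMl.
  by lra.
suff : fnorm a i - e <= cnrm a by lra.
apply: lb_le_inf; first by case: (cnrm_inf a).
move=> _ [b Kb <-]; apply/ler_addgt0Pr => t t0.
have /KP/cvgr0Pnorm_lt/(_ _ t0)[r r0 br] := Kb.
have [i' [ri' di']] : exists i', mdist j (al i') < r /\ mdist j (al i') < d / 2.
  have : G [set i | mdist j (al i) < Num.min r (d / 2)].
    by exists (Num.min r (d / 2)) => //=; rewrite lt_min r0.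
  by move=> /filter_ex[i' /=]; rewrite lt_min => /andP[]; exists i'.
have := br i' ri'; rewrite /= ger0_norm ?fnorm_ge0// => bt.
have /ad : mdist i i' < d.
  rewrite -hal.1 (le_lt_trans (metric_triangle _ j _))// (splitr d).
  by rewrite ltrD// metric_sym.
rewrite ltr_norml => /andP[_].
have := fnormB b a i'; rewrite distrC ler_norml => /andP[_].
have := fnorm_le b i'; lra.
Qed.

End IdealTheory.

Lemma exists_half_lt (R : realType) (e : R) : 0 < e ->
  exists n, 2^-1 ^+ n < e.
Proof.
move=> e0; exists (Num.truncn e^-1).+1; rewrite exprVn invf_plt ?posrE ?exprn_gt0//.
apply: lt_trans (truncnS_gt _) _.
by rewrite -natrX ltr_nat ltn_expl.
Qed.

(* The quotient of the section algebra by extension_ideal A al j, with the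
   quotient norm. It is a C*-algebra because that norm is the limit of the fibre
   norms at j (fnorm_cvg); this uses that al is a dense isometric embedding,
   hence the hypothesis among the parameters of the quotient. *)
Section QuotientAlgebra.
Context (R : realType) (I J : metricType R) (A : ucbBundle I) (al : I -> J).

Definition ideal_pred of dense_isometric_embedding al := fun (j : J) =>
  (fun a => `[< extension_ideal A al j a >]) : {pred sections A}.

Context (hal : dense_isometric_embedding al) (j : J).
Implicit Types a b : sections A.

Lemma ideal_predP a : reflect (extension_ideal A al j a) (a \in ideal_pred hal j).
Proof. exact: asboolP. Qed.

Lemma ideal_zmod_closed : GRing.zmod_closed (ideal_pred hal j).
Proof.
split=> [|a b /ideal_predP Ka /ideal_predP Kb]; apply/ideal_predP.
  exact: ideal0.
exact: idealB.
Qed.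

HB.instance Definition _ :=
  GRing.isZmodClosed.Build (sections A) (ideal_pred hal j) ideal_zmod_closed.

Definition ideal_quot := Quotient.quot (ideal_pred hal j).

HB.instance Definition _ := GRing.Zmodule.on ideal_quot.

Definition ideal_pi (a : sections A) : ideal_quot := (\pi_ideal_quot a)%qT.

Lemma ideal_piP a b : ideal_pi a = ideal_pi b <-> extension_ideal A al j (a - b).
Proof.
rewrite /ideal_pi; split.
  by move=> /eqP; rewrite -Quotient.idealrBE => /ideal_predP.
by move=> /ideal_predP; rewrite Quotient.idealrBE => /eqP.
Qed.

Definition ideal_repr (x : ideal_quot) : sections A := repr x.

Lemma ideal_reprK x : ideal_pi (ideal_repr x) = x.
Proof. exact: reprK. Qed.

Lemma ideal_pi_reprB a : extension_ideal A al j (ideal_repr (ideal_pi a) - a).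
Proof. by apply/ideal_piP; rewrite ideal_reprK. Qed.

Lemma ideal_piD a b : ideal_pi (a + b) = ideal_pi a + ideal_pi b.
Proof. by rewrite /ideal_pi !piE. Qed.

Lemma ideal_piB a b : ideal_pi (a - b) = ideal_pi a - ideal_pi b.
Proof. by rewrite /ideal_pi !piE. Qed.

Lemma ideal_quot_ind (P : ideal_quot -> Prop) :
  (forall a, P (ideal_pi a)) -> forall x, P x.
Proof. by move=> h x; rewrite -(ideal_reprK x). Qed.

Definition quot_scale (c : R[i]) (x : ideal_quot) := ideal_pi (c *: ideal_repr x).
Definition quot_mul (x y : ideal_quot) :=
  ideal_pi (cmul (ideal_repr x) (ideal_repr y)).
Definition quot_star (x : ideal_quot) := ideal_pi (cstar (ideal_repr x)).
Definition quot_norm (x : ideal_quot) : R[i] :=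
  (inf [set rnorm a | a in [set a | ideal_pi a = x]])%:C%C.

Lemma quot_scaleE c a : quot_scale c (ideal_pi a) = ideal_pi (c *: a).
Proof.
by apply/ideal_piP; rewrite -scalerBr; apply: idealZ => //; exact: ideal_pi_reprB.
Qed.

Lemma quot_mulE a b : quot_mul (ideal_pi a) (ideal_pi b) = ideal_pi (cmul a b).
Proof.
apply/ideal_piP.
set a' := ideal_repr _; set b' := ideal_repr _.
have -> : cmul a' b' - cmul a b = cmul (a' - a) b' - cmul a (b - b').
  by rewrite cmulBl cmulBr opprB addrA subrK.
apply: idealB => //; first by apply: idealMr => //; exact: ideal_pi_reprB.
apply: idealMl => //; rewrite -opprB -[- _]scaleN1r.
by apply: idealZ => //; exact: ideal_pi_reprB.
Qed.

Lemma quot_starE a : quot_star (ideal_pi a) = ideal_pi (cstar a).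
Proof.
by apply/ideal_piP; rewrite -cstarB; apply: idealS => //; exact: ideal_pi_reprB.
Qed.

Lemma quot_normE a : quot_norm (ideal_pi a) = (cnrm al j a)%:C%C.
Proof.
rewrite /quot_norm /cnrm; congr ((inf [set rnorm b | b in _])%:C%C).
by apply/seteqP; split => b /= /ideal_piP.
Qed.

Fact quot_scalerA (a b : R[i]) v : quot_scale a (quot_scale b v) = quot_scale (a * b) v.
Proof. by elim/ideal_quot_ind: v => v; rewrite !quot_scaleE scalerA. Qed.

Fact quot_scale1r : left_id 1 quot_scale.
Proof. by elim/ideal_quot_ind => v; rewrite !quot_scaleE scale1r. Qed.

Fact quot_scalerDr : right_distributive quot_scale +%R.
Proof.
move=> c; elim/ideal_quot_ind => a; elim/ideal_quot_ind => b.
by rewrite -ideal_piD !quot_scaleE scalerDr ideal_piD.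
Qed.

Fact quot_scalerDl v : {morph quot_scale^~ v : a b / a + b}.
Proof.
move=> c d; elim/ideal_quot_ind: v => v.
by rewrite !quot_scaleE scalerDl ideal_piD.
Qed.

HB.instance Definition _ := GRing.Zmodule_isLmodule.Build R[i] ideal_quot
  quot_scalerA quot_scale1r quot_scalerDr quot_scalerDl.

Lemma ideal_piZ c a : ideal_pi (c *: a) = c *: ideal_pi a.
Proof. by rewrite -quot_scaleE. Qed.

Let GF : ProperFilter (near_pt al j) := near_pt_filter j hal.
#[local] Existing Instance GF.

Let limE a l : fnorm a i @[i --> near_pt al j] --> l -> cnrm al j a = l.
Proof. by apply: cvg_unique => //; exact: fnorm_cvg. Qed.

Lemma cnrmD a b : cnrm al j (a + b) <= cnrm al j a + cnrm al j b.
Proof.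
have ab := cvgD (@fnorm_cvg _ _ _ _ _ hal j a) (@fnorm_cvg _ _ _ _ _ hal j b).
by refine (ler_cvg_to (@fnorm_cvg _ _ _ _ _ hal j (a + b)) (ab _) (nearW _ _)); exact: fnormD.
Qed.

Lemma cnrmM a b : cnrm al j (cmul a b) <= cnrm al j a * cnrm al j b.
Proof.
have ab := cvgM (@fnorm_cvg _ _ _ _ _ hal j a) (@fnorm_cvg _ _ _ _ _ hal j b).
by refine (ler_cvg_to (@fnorm_cvg _ _ _ _ _ hal j (cmul a b)) (ab _) (nearW _ _)); exact: fnormM.
Qed.

Lemma cnrmZ c a : cnrm al j (c *: a) = complex.Re `|c| * cnrm al j a.
Proof.
apply: limE; rewrite (_ : fnorm (c *: a) = fun i => complex.Re `|c| * fnorm a i).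
  by apply: cvgM; [exact: cvg_cst|exact: fnorm_cvg].
by apply/funext => i; rewrite fnormZ.
Qed.

Lemma cnrmS a : cnrm al j (cmul (cstar a) a) = cnrm al j a ^+ 2.
Proof.
apply: limE; rewrite (_ : fnorm _ = fun i => fnorm a i * fnorm a i).
  by rewrite expr2; apply: cvgM; exact: fnorm_cvg.
by apply/funext => i; rewrite fnormSM.
Qed.

Lemma cnrm_eq0 a : cnrm al j a = 0 -> extension_ideal A al j a.
Proof.
by move=> a0; apply/extension_ideal_cvg => //; rewrite -a0; exact: fnorm_cvg.
Qed.

Lemma cnrm_le a : cnrm al j a <= rnorm a.
Proof.
apply: ge_inf; first by case: (cnrm_inf hal j a).
by exists a => //=; rewrite subrr; exact: ideal0.
Qed.

Fact quot_normD x y : quot_norm (x + y) <= quot_norm x + quot_norm y.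
Proof.
elim/ideal_quot_ind: x => a; elim/ideal_quot_ind: y => b.
by rewrite -ideal_piD !quot_normE -rmorphD lecR cnrmD.
Qed.

Fact quot_normZ (c : R[i]) x : quot_norm (c *: x) = `|c| * quot_norm x.
Proof.
elim/ideal_quot_ind: x => a.
by rewrite -ideal_piZ !quot_normE cnrmZ rmorphM.
Qed.

Fact quot_norm_eq0 x : quot_norm x = 0 -> x = 0.
Proof.
elim/ideal_quot_ind: x => a; rewrite quot_normE => /(@complexI R) a0.
have -> : 0 = ideal_pi 0 by rewrite /ideal_pi !piE.
by apply/ideal_piP; rewrite subr0; exact: cnrm_eq0.
Qed.

HB.instance Definition _ := Lmodule_isNormed.Build R[i] ideal_quot
  quot_normD quot_normZ quot_norm_eq0.

Lemma ideal_norm_pi a : `|ideal_pi a| = (cnrm al j a)%:C%C.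
Proof. exact: quot_normE. Qed.

Lemma ideal_lift x (e : R) : `|x : ideal_quot| < e%:C%C ->
  exists2 a, ideal_pi a = x & rnorm a < e.
Proof.
elim/ideal_quot_ind: x => a; rewrite ideal_norm_pi ltcR => ae.
have e0 : 0 < e - cnrm al j a by rewrite subr_gt0.
have [_ [b /= Kb <-]] := inf_adherent e0 (cnrm_inf hal j a).
rewrite -/(cnrm al j a) addrC subrK => be.
by exists b => //; apply/ideal_piP.
Qed.

End QuotientAlgebra.

Section QuotientCStar.
Context (R : realType) (I J : metricType R) (A : ucbBundle I) (al : I -> J).
Context (hal : dense_isometric_embedding al) (j : J).
Implicit Types a b : sections A.
Local Notation Q := (ideal_quot A hal j).
Local Notation pi := (ideal_pi hal j).

Lemma rnorm_cvg (a : nat -> sections A) :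
  (forall n m, rnorm (a (n + m)%N - a n) <= 4 * 2^-1 ^+ n) ->
  exists b, forall n, rnorm (b - a n) <= 4 * 2^-1 ^+ n.
Proof.
move=> ca.
have ah (n m : nat) : (n <= m)%N -> rnorm (a m - a n) <= 4 * 2^-1 ^+ n.
  by move=> nm; rewrite -(subnKC nm).
have : cvg (a @ \oo).
  apply: cauchy_cvg; apply/cauchyP => e e0.
  have er : 0 < complex.Re e by move: e0; rewrite ltcE => /andP[_].
  have ee : e = (complex.Re e)%:C%C by rewrite RRe_real// gtr0_real.
  have [n ne] := exists_half_lt (divr_gt0 er (ltr0n R 4)).
  exists (a n); exists n => // m /= nm.
  rewrite -ball_normE/= distrC rnormE ee ltcR (le_lt_trans (ah _ _ nm))//.
  by rewrite mulrC -ltr_pdivlMr.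
move=> /cvg_ex[b ab]; exists b => n; apply/ler_addgt0Pr => t t0.
have t0c : 0 < t%:C%C by rewrite ltcR.
have /cvgrPdist_lt/(_ _ t0c)[m _ bm] := ab.
have := bm (maxn n m) (leq_maxr _ _); rewrite /= rnormE ltcR => bt.
have := ah n (maxn n m) (leq_maxl _ _).
have := rnormD (b - a (maxn n m)) (a (maxn n m) - a n).
by rewrite addrA subrK; lra.
Qed.

Fact ideal_quot_complete (F : set_system Q) :
  ProperFilter F -> cauchy F -> cvg F.
Proof.
move=> FF /cauchyP Fc.
have hp (n : nat) : 0 < (2^-1 ^+ n)%:C%C :> R[i].
  by rewrite ltcR exprn_gt0// invr_gt0.
have [x xF] := choice (fun n => Fc _ (hp n)).
have xx (n : nat) : `|x n.+1 - x n| < (2 * 2^-1 ^+ n)%:C%C :> R[i].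
  have [y []] := filter_ex (filterI (xF n) (xF n.+1)).
  rewrite -!ball_normE/= => xy xy1.
  rewrite -(subrK y (x n.+1)) -addrA (le_lt_trans (ler_normD _ _))//.
  rewrite (distrC y); have := ltrD xy1 xy; move=> /lt_le_trans; apply.
  rewrite -rmorphD lecR exprS; have := hp n; rewrite ltcR; lra.
have [d dP] := choice (fun n => let: ex_intro2 a p q := ideal_lift (xx n) in
  ex_intro (fun a => pi a = x n.+1 - x n /\ rnorm a < 2 * 2^-1 ^+ n) a (conj p q)).
pose a n := ideal_repr (x 0%N) + \sum_(k < n) d k.
have aS n : a n.+1 = a n + d n by rewrite /a big_ord_recr/= addrA.
have pa n : pi (a n) = x n.
  elim: n => [|n IH]; first by rewrite /a big_ord0 addr0 ideal_reprK.
  by rewrite aS ideal_piD IH (dP n).1 addrC subrK.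
have [|b ba] := @rnorm_cvg a.
  move=> n m; suff : rnorm (a (n + m)%N - a n) <= 4 * 2^-1 ^+ n - 4 * 2^-1 ^+ (n + m).
    by move/le_trans; apply; rewrite gerBl mulr_ge0// exprn_ge0// invr_ge0.
  elim: m => [|m IH]; first by rewrite addn0 !subrr rnorm0.
  rewrite addnS aS addrAC (le_trans (rnormD _ _))// exprS.
  have := (dP (n + m)%N).2; lra.
apply/cvg_ex; exists (pi b); apply/cvg_ballP => e e0.
have er : 0 < complex.Re e by move: e0; rewrite ltcE => /andP[_].
have ee : e = (complex.Re e)%:C%C by rewrite RRe_real// gtr0_real.
have [n ne] := exists_half_lt (divr_gt0 er (ltr0n R 5)).
apply: filterS (xF n) => y; rewrite -!ball_normE/= => xy.
rewrite -(subrK (x n) (pi b)) -addrA (le_lt_trans (ler_normD _ _))//.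
have bn : `|pi b - x n| <= (4 * 2^-1 ^+ n)%:C%C.
  by rewrite -pa -ideal_piB ideal_norm_pi lecR (le_trans (cnrm_le hal j _)).
have := ler_ltD bn xy; move=> /lt_trans; apply.
rewrite ee -rmorphD ltcR; move: ne; rewrite ltr_pdivlMr//; lra.
Qed.

HB.instance Definition _ := Uniform_isComplete.Build Q ideal_quot_complete.

Local Notation mul := (@quot_mul R I J A al hal j).
Local Notation star := (@quot_star R I J A al hal j).

Fact quot_mulA : associative mul.
Proof.
elim/ideal_quot_ind => x; elim/ideal_quot_ind => y; elim/ideal_quot_ind => z.
by rewrite !quot_mulE cmulA.
Qed.

Fact quot_mulDl x y z : mul (x + y) z = mul x z + mul y z.
Proof.
elim/ideal_quot_ind: x => x; elim/ideal_quot_ind: y => y.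
by elim/ideal_quot_ind: z => z; rewrite -ideal_piD !quot_mulE -ideal_piD cmulDl.
Qed.

Fact quot_mulDr x y z : mul x (y + z) = mul x y + mul x z.
Proof.
elim/ideal_quot_ind: x => x; elim/ideal_quot_ind: y => y.
by elim/ideal_quot_ind: z => z; rewrite -ideal_piD !quot_mulE -ideal_piD cmulDr.
Qed.

Fact quot_mulZl (c : R[i]) x y : mul (c *: x) y = c *: mul x y.
Proof.
elim/ideal_quot_ind: x => x; elim/ideal_quot_ind: y => y.
by rewrite -ideal_piZ !quot_mulE -ideal_piZ cmulZl.
Qed.

Fact quot_mulZr (c : R[i]) x y : mul x (c *: y) = c *: mul x y.
Proof.
elim/ideal_quot_ind: x => x; elim/ideal_quot_ind: y => y.
by rewrite -ideal_piZ !quot_mulE -ideal_piZ cmulZr.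
Qed.

Fact quot_normM (x y : Q) : `|mul x y| <= `|x| * `|y|.
Proof.
elim/ideal_quot_ind: x => x; elim/ideal_quot_ind: y => y.
by rewrite quot_mulE !ideal_norm_pi -rmorphM lecR cnrmM.
Qed.

Fact quot_starK : involutive star.
Proof. by elim/ideal_quot_ind => x; rewrite !quot_starE cstarK. Qed.

Fact quot_starD x y : star (x + y) = star x + star y.
Proof.
elim/ideal_quot_ind: x => x; elim/ideal_quot_ind: y => y.
by rewrite -ideal_piD !quot_starE -ideal_piD cstarD.
Qed.

Fact quot_starZ (c : R[i]) x : star (c *: x) = conjc c *: star x.
Proof.
elim/ideal_quot_ind: x => x.
by rewrite -ideal_piZ !quot_starE -ideal_piZ cstarZ.
Qed.

Fact quot_starM x y : star (mul x y) = mul (star y) (star x).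
Proof.
elim/ideal_quot_ind: x => x; elim/ideal_quot_ind: y => y.
by rewrite !(quot_mulE, quot_starE) cstarM.
Qed.

Fact quot_norm_star (x : Q) : `|mul (star x) x| = `|x| ^+ 2.
Proof.
elim/ideal_quot_ind: x => x.
by rewrite quot_starE quot_mulE !ideal_norm_pi cnrmS // !expr2 rmorphM.
Qed.

HB.instance Definition _ := CompleteNormedModule_isCStarAlgebra.Build R Q
  quot_mulA quot_mulDl quot_mulDr quot_mulZl quot_mulZr quot_normM
  quot_starK quot_starD quot_starZ quot_starM quot_norm_star.

End QuotientCStar.

Section MinimalExtensionBundle.
Context (R : realType) (I J : metricType R) (A : ucbBundle I) (al : I -> J).
Context (hal : dense_isometric_embedding al).
Implicit Types a b : sections A.

Definition quot_fibre (j : J) : cstarAlgType R := ideal_quot A hal j.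
Definition quot_ev (j : J) (a : sections A) : quot_fibre j := ideal_pi hal j a.

Fact quot_ev_star_hom j : star_hom (@quot_ev j).
Proof.
split=> [c x y|x y|x].
- by rewrite /quot_ev ideal_piD ideal_piZ.
- by rewrite /quot_ev -quot_mulE.
- by rewrite /quot_ev -quot_starE.
Qed.

Fact quot_ev_surj j (y : quot_fibre j) : exists a, quot_ev j a = y.
Proof. by exists (ideal_repr y); exact: ideal_reprK. Qed.

Lemma quot_rnormE j a : rnorm (quot_ev j a) = cnrm al j a.
Proof. by apply: (@complexI R); rewrite -rnormE; exact: ideal_norm_pi. Qed.

(* at the points of I the quotient norm is the norm of the original fibre *)
Lemma cnrm_al a i : cnrm al (al i) a = fnorm a i.
Proof.
have GF := near_pt_filter (al i) hal.
have ca := @fnorm_cvg _ _ _ _ _ hal (al i) a.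
suff ci : fnorm a x @[x --> near_pt al (al i)] --> fnorm a i.
  exact: (cvg_unique (@Rhausdorff R) ca ci).
apply/cvgrPdist_lt => e e0.
have [/(_ _ e0)[d d0 ad] _] := fnorm_ucb a.
by exists d => //= x /=; rewrite hal.1 => /ad.
Qed.

Fact quot_rnorm_sup a :
  rnorm a = sup [set rnorm (quot_ev j a) | j in [set: J]].
Proof.
have [I0|/set0P[i _]] := eqVneq [set: I] set0.
  have -> : [set rnorm (quot_ev j a) | j in [set: J]] = set0.
    apply/seteqP; split=> // y [j _ _].
    have J0 : [set: J] !=set0 by exists j.
    have [x [_ [i _ _]]] := hal.2 [set: J] J0 openT.
    by have : [set: I] i by []; rewrite I0.
  rewrite sup0; apply/eqP; rewrite eq_le rnorm_ge0 andbT.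
  by apply: rnorm_le => // i; have : [set: I] i by []; rewrite I0.
have ub : ubound [set rnorm (quot_ev j a) | j in [set: J]] (rnorm a).
  by move=> _ [j _ <-]; rewrite quot_rnormE cnrm_le.
apply/eqP; rewrite eq_le; apply/andP; split.
  apply: rnorm_le => [|x].
    apply: le_trans (ub_le_sup (ex_intro _ _ ub) (ex_intro2 _ _ (al i) Logic.I erefl)).
    exact: rnorm_ge0.
  by apply: ub_le_sup; [exists (rnorm a)|exists (al x) => //; rewrite quot_rnormE cnrm_al].
by apply: ge_sup => //; exists (rnorm (quot_ev (al i) a)), (al i).
Qed.

Lemma UCb_comp (f : J -> R[i]^o) : UCb f -> UCb (f \o al).
Proof.
move=> [fu [M [Mr fM]]]; split; last first.
  by exists M; split => // x Mx i _; exact: (fM x Mx (al i) Logic.I).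
move=> E /fu; rewrite /nbhs/= -!entourage_ballE => -[d d0 dE].
exists d => //= -[x y]; rewrite /= ballEmdist/= -hal.1 => xy.
by apply: (dE (al x, al y)); rewrite /= ballEmdist.
Qed.

Fact quot_ucb_mul (f : J -> R[i]^o) a : UCb f ->
  exists fa, forall j, quot_ev j fa = f j *: quot_ev j a.
Proof.
move=> fu; have [b bE] := ucb_mul a (UCb_comp fu).
exists b => j; rewrite /quot_ev -ideal_piZ; apply/ideal_piP.
have GF := near_pt_filter j hal.
apply/extension_ideal_cvg => //; apply/cvgrPdist_lt => e e0.
pose M := rnorm a + 1.
have M0 : 0 < M by rewrite ltr_pwDr// rnorm_ge0.
have eM0 : 0 < (e / M)%:C%C :> R[i] by rewrite ltcR divr_gt0.
have : nbhs (f j) (ball (f j : R[i]^o) (e / M)%:C%C) by exact: nbhsx_ballx.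
have fe : entourage [set xy : R[i]^o * R[i]^o | ball xy.1 (e / M)%:C%C xy.2].
  by rewrite -entourage_ballE; exists (e / M)%:C%C.
move=> _; have := fu.1 _ fe; rewrite /nbhs/= -entourage_ballE => -[d d0 dE].
exists d => //= i ji.
have /= : [set xy : R[i]^o * R[i]^o | ball xy.1 (e / M)%:C%C xy.2] (f j, f (al i)).
  by apply: (dE (j, al i)); rewrite /= ballEmdist.
rewrite /ball/= => fji.
rewrite sub0r normrN ger0_norm ?fnorm_ge0//.
rewrite /fnorm (star_homB (ev_star_hom A i)) bE (star_homZ (ev_star_hom A i)).
rewrite -scalerBl rnormZ distrC.
have : complex.Re `|f j - f (al i)| < e / M.
  by move: fji; rewrite ltcE/= => /andP[_].
rewrite ltr_pdivlMr//; apply: le_lt_trans.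
apply: ler_wpM2l; last first.
  by rewrite -/(fnorm a i) (le_trans (fnorm_le a i))// lerDl.
by rewrite -ler0c RRe_real// ger0_real.
Qed.

Fact quot_ucb_norm a : UCb (fun j => `|quot_ev j a|).
Proof.
rewrite (_ : (fun j => _) = (fun j => (cnrm al j a)%:C%C)); last first.
  by apply/funext => j; rewrite rnormE quot_rnormE.
apply/UCb_realP; split => [e e0|]; last first.
  exists (rnorm a) => j; rewrite ger0_norm ?cnrm_le//.
  by rewrite -quot_rnormE rnorm_ge0.
have e40 : 0 < e / 4 by rewrite divr_gt0.
have [/(_ _ e40)[d d0 ad] _] := fnorm_ucb a.
have d30 : 0 < d / 3 by rewrite divr_gt0.
have nearE j : exists2 i, mdist j (al i) < d / 3 & `|cnrm al j a - fnorm a i| < e / 4.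
  have GF := near_pt_filter j hal.
  have /cvgrPdist_lt/(_ _ e40) near1 := @fnorm_cvg _ _ _ _ _ hal j a.
  have near2 : near_pt al j [set i | mdist j (al i) < d / 3] by exists (d / 3).
  by have [i [? ?]] := filter_ex (filterI near1 near2); exists i.
exists (d / 3) => // x y xy.
have [i xi xa] := nearE x; have [k yk ya] := nearE y.
have /ad : mdist i k < d.
  rewrite -hal.1; have := metric_triangle (al i) x (al k).
  have := metric_triangle x y (al k); rewrite (metric_sym (al i) x); lra.
move: xa ya; rewrite !ltr_norml => /andP[? ?] /andP[? ?] /andP[? ?].
by apply/andP; split; lra.
Qed.

Definition minimal_extension : ucbBundle J := UCbBundle
  quot_ev_star_hom quot_ev_surj quot_rnorm_sup quot_ucb_mul quot_ucb_norm.

End MinimalExtensionBundle.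

Record category := Category {
  obj : Type;
  hom : obj -> obj -> Type;
  idm : forall X, hom X X;
  comp : forall X Y Z, hom Y Z -> hom X Y -> hom X Z;
  comp_idl : forall X Y (f : hom X Y), comp (idm Y) f = f;
  comp_idr : forall X Y (f : hom X Y), comp f (idm X) = f;
  compA : forall X Y Z W (h : hom Z W) (g : hom Y Z) (f : hom X Y),
    comp h (comp g f) = comp (comp h g) f }.

Definition is_functor (C D : category) (Fo : obj C -> obj D)
    (Fm : forall X Y : obj C, hom X Y -> hom (Fo X) (Fo Y)) :=
  (forall X : obj C, Fm X X (idm X) = idm (Fo X)) /\
  (forall (X Y Z : obj C) (g : hom Y Z) (f : hom X Y),
     Fm X Z (comp g f) = comp (Fm Y Z g) (Fm X Y f)).

Section DynamicalBundles.
Context (R : realType).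

Definition bundle_hom (I J : metricType R) (A : ucbBundle I) (B : ucbBundle J)
    (al : I -> J) (be : sections A -> sections B) :=
  [/\ metric_map al, star_hom be &
      forall (h : I) (a1 a2 : sections A),
        ev h a1 = ev h a2 -> ev (al h) (be a1) = ev (al h) (be a2)].

(* no continuity in t is required *)
Definition one_parameter_group (A : cstarAlgType R) (tau : R -> A -> A) :=
  [/\ forall t, star_aut (tau t),
      forall a, tau 0 a = a &
      forall s t a, tau (s + t) a = tau s (tau t a)].

Definition is_dynamical (I : metricType R) (A : ucbBundle I)
    (tau : R -> sections A -> sections A) :=
  one_parameter_group tau /\
  forall (h : I) (t : R), exists2 tauh : fibre A h -> fibre A h,
    star_aut tauh & forall a, tauh (ev h a) = ev h (tau t a).

Context (coll : metricType R -> Prop).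

Record dynBundle := DynBundle {
  base : metricType R;
  base_coll : coll base;
  bundle : ucbBundle base;
  flow : R -> sections bundle -> sections bundle;
  flow_dynamical : is_dynamical flow }.

Definition is_dynHom (X Y : dynBundle) (al : base X -> base Y)
    (be : sections (bundle X) -> sections (bundle Y)) :=
  [/\ bundle_hom al be, proper_map al &
      forall t a, flow t (be a) = be (flow t a)].

Record dynHom (X Y : dynBundle) := DynHom {
  hom_base : base X -> base Y;
  hom_sections : sections (bundle X) -> sections (bundle Y);
  hom_is_dynHom : is_dynHom hom_base hom_sections }.

Lemma dynHom_eq (X Y : dynBundle) (s u : dynHom X Y) :
  hom_base s = hom_base u -> hom_sections s = hom_sections u -> s = u.
Proof.
case: s u => [a b h] [a' b' h'] /= ea eb; subst a' b'.
by congr DynHom; exact: Prop_irrelevance.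
Qed.

Fact dynHom_id_subproof (X : dynBundle) :
  is_dynHom (@id (base X)) (@id (sections (bundle X))).
Proof.
by split=> //; split=> // x y; exact: lexx.
Qed.

Fact dynHom_comp_subproof (X Y Z : dynBundle) (u : dynHom Y Z) (s : dynHom X Y) :
  is_dynHom (hom_base u \o hom_base s) (hom_sections u \o hom_sections s).
Proof.
case: u s => [a2 b2 [[m2 [l2 M2 S2] e2] p2 f2]].
move=> [a1 b1 [[m1 [l1 M1 S1] e1] p1 f1]]; split=> [|K cK|t a] /=.
- split=> [x y|| h x y /e1/e2 //]; first exact: le_trans (m2 _ _) (m1 _ _).
  by split=> [c x y|x y|x] /=; [rewrite l1 l2|rewrite M1 M2|rewrite S1 S2].
- exact: p1 (p2 _ cK).
- by rewrite f2 f1.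
Qed.

Definition dynHom_id (X : dynBundle) : dynHom X X :=
  DynHom (dynHom_id_subproof X).

Definition dynHom_comp (X Y Z : dynBundle) (u : dynHom Y Z) (s : dynHom X Y) :
  dynHom X Z := DynHom (dynHom_comp_subproof u s).

Fact dynHom_idl (X Y : dynBundle) (s : dynHom X Y) :
  dynHom_comp (dynHom_id Y) s = s.
Proof. exact: dynHom_eq. Qed.

Fact dynHom_idr (X Y : dynBundle) (s : dynHom X Y) :
  dynHom_comp s (dynHom_id X) = s.
Proof. exact: dynHom_eq. Qed.

Fact dynHom_compA (X Y Z W : dynBundle) (u : dynHom Z W) (v : dynHom Y Z)
    (s : dynHom X Y) :
  dynHom_comp u (dynHom_comp v s) = dynHom_comp (dynHom_comp u v) s.
Proof. exact: dynHom_eq. Qed.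

Definition DBun : category := @Category dynBundle dynHom dynHom_id dynHom_comp
  dynHom_idl dynHom_idr dynHom_compA.

(* C, alpha and Cmap are total functions, constrained only on coll and on proper
   metric maps. An assignment defined on coll alone extends to such functions,
   with C I := I and alpha I := id outside coll. *)
Definition functorial_assignment (C : metricType R -> metricType R)
    (alpha : forall I : metricType R, I -> C I)
    (Cmap : forall I J : metricType R, (I -> J) -> C I -> C J) :=
  (forall (I J : metricType R) (f : I -> J), coll I -> coll J ->
     metric_map f -> proper_map f ->
     continuous (Cmap I J f) /\
     forall x, Cmap I J f (alpha I x) = alpha J (f x)) /\
  (forall (I J K : metricType R) (f : I -> J) (g : J -> K),
     coll I -> coll J -> coll K ->
     metric_map f -> proper_map f -> metric_map g -> proper_map g ->
     forall x, Cmap I K (g \o f) x = Cmap J K g (Cmap I J f x)).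

End DynamicalBundles.

Arguments is_functor : clear implicits.
Arguments is_dynamical {R I} A tau.
Arguments flow {R coll} d _ _.
Arguments is_dynHom {R coll} X Y al be.
Arguments functorial_assignment {R} coll C alpha Cmap.

Definition Ccoll (R : realType) (C : metricType R -> metricType R)
    (coll : metricType R -> Prop) (J : metricType R) :=
  exists2 I, coll I & J = C I.

Fact Ccoll_base (R : realType) (C : metricType R -> metricType R)
  (coll : metricType R -> Prop) (X : dynBundle coll) : Ccoll C coll (C (base X)).
Proof. by exists (base X) => //; exact: base_coll. Qed.

Section ExtensionFunctor.
Context (R : realType) (coll : metricType R -> Prop).
Context (C : metricType R -> metricType R).
Context (alpha : forall I : metricType R, I -> C I).
Context (Cmap : forall I J : metricType R, (I -> J) -> C I -> C J).
Hypothesis halpha : forall I, coll I -> dense_isometric_embedding (@alpha I).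

Definition F_bundle (X : dynBundle coll) : ucbBundle (C (base X)) :=
  minimal_extension (bundle X) (halpha (base_coll X)).

(* The sections of F_bundle X are those of bundle X, so flow X is a family of
   self-maps of both. *)
Hypothesis F_dynamical :
  forall X : dynBundle coll, is_dynamical (F_bundle X) (flow X).

Definition FD_obj (X : dynBundle coll) : dynBundle (Ccoll C coll) :=
  DynBundle (Ccoll_base C X) (F_dynamical X).

Hypothesis F_dynHom : forall (X Y : dynBundle coll) (s : dynHom X Y),
  is_dynHom (FD_obj X) (FD_obj Y)
    (Cmap (hom_base s)) (hom_sections s).

Definition FD_hom (X Y : dynBundle coll) (s : dynHom X Y) :
  dynHom (FD_obj X) (FD_obj Y) := DynHom (F_dynHom s).

End ExtensionFunctor.

Arguments F_bundle {R coll C alpha} halpha X.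
Arguments FD_obj {R coll C alpha halpha} F_dynamical X.
Arguments FD_hom {R coll C alpha Cmap halpha F_dynamical} F_dynHom X Y s.

(* Main.v *)
Require Import Defs.
From mathcomp Require Import all_boot all_order all_algebra.
From mathcomp Require Import all_classical all_reals all_analysis.
From mathcomp Require Import complex.
From mathcomp Require Import ring lra.

(** The sections of the minimal extension are the sections of the bundle one
    started from, so the extension does not change the algebra map and the flow,
    and everything that has to be checked is a compatibility with the ideals
    [extension_ideal A al j] defining the new fibres.

    The heart of the matter is that a *-homomorphism of C*-algebras is
    contractive ([star_hom_contractive]).  A homomorphism of bundles induces
    *-homomorphisms between fibres, hence does not increase fibre norms
    ([fnorm_hom_le]).  The norm in a fibre of the minimal extension is the limit
    of the old fibre norms along points tending to [j], so this inequality
    survives the passage to the limit ([cnrm_hom_le]): the ideal at [j] is mapped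
    into the ideal at the image of [j].  This extends homomorphisms
    ([minimal_extension_hom]).  It also extends flows
    ([minimal_extension_dynamical]), because each time-[t] map of a dynamical
    bundle is a homomorphism of bundles over the identity of the base.  The two
    functor laws then concern the base maps only; composition is the
    functoriality of the assignment, and the identity law holds since a
    continuous map is determined by its values on a dense subset.

    Contractivity is proved without spectral theory and without adjoining units.
    For a self-adjoint [a] of norm less than 1 the element
    a + i sqrt (1 - a^2) is formally unitary, where sqrt (1 - a^2) = 1 - s
    for some [s] in the algebra itself, found by iterating a contraction
    ([sqrt_one_sub]).  Left multiplication by the image
    f(a) + i (1 - f(s)) and by its adjoint are isometries of the target, and f(a)
    is half their sum, so it has norm at most 1 ([star_hom_le1]).  The general
    case follows by scaling and by the C*-identity. *)

Set Implicit Arguments.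
Unset Strict Implicit.
Unset Printing Implicit Defensive.

Import Order.TTheory GRing.Theory Num.Theory.
Import numFieldNormedType.Exports.

Local Open Scope classical_set_scope.
Local Open Scope ring_scope.

(** * Geometric convergence and square roots in a C*-algebra *)

Section GeometricSequences.
Context (R : realType) (A : cstarAlgType R).
Implicit Types (a b x y : A) (q K : R).

Lemma rnormZr (r : R) a : rnorm (r%:C%C *: a) = `|r| * rnorm a.
Proof. by rewrite rnormZ normc_def/= expr0n addr0 sqrtr_sqr. Qed.

Lemma geometric_lt q K e : 0 <= q < 1 -> 0 < e -> exists n, K * q ^+ n < e.
Proof.
move=> /andP[q0 q1] e0.
have q1' : `|q| < 1 by rewrite ger0_norm.
have /cvgr0Pnorm_lt/(_ _ e0)[n _ /(_ n (leqnn n))/= Kq] := cvg_geometric K q1'.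
by exists n; exact: le_lt_trans (ler_norm _) Kq.
Qed.

Lemma rnorm_geometric_eq0 q K y : 0 <= q < 1 ->
  (forall n, rnorm y <= K * q ^+ n) -> y = 0.
Proof.
move=> q01 yK; apply: rnorm_eq0; apply/eqP; rewrite eq_le rnorm_ge0 andbT.
apply/ler_addgt0Pr => e e0; rewrite add0r.
by have [n /ltW] := geometric_lt K q01 e0; exact: le_trans.
Qed.

Lemma rnorm_geometric_cvg q K (u : nat -> A) : 0 <= q < 1 ->
  (forall n m, rnorm (u (n + m)%N - u n) <= K * q ^+ n) ->
  exists s, forall n, rnorm (s - u n) <= K * q ^+ n.
Proof.
move=> q01 cu.
have uh (n m : nat) : (n <= m)%N -> rnorm (u m - u n) <= K * q ^+ n.
  by move=> nm; rewrite -(subnKC nm).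
have /cvg_ex[s us] : cvg (u @ \oo).
  apply: cauchy_cvg; apply/cauchyP => e e0.
  have er : 0 < complex.Re e by move: e0; rewrite ltcE => /andP[_].
  have ee : e = (complex.Re e)%:C%C by rewrite RRe_real// gtr0_real.
  have [n ne] := geometric_lt K q01 er.
  exists (u n); exists n => // m /= nm.
  by rewrite -ball_normE/= distrC rnormE ee ltcR (le_lt_trans (uh _ _ nm)).
exists s => n; apply/ler_addgt0Pr => t t0.
have t0c : 0 < t%:C%C by rewrite ltcR.
have /cvgrPdist_lt/(_ _ t0c)[m _ sm] := us.
have := sm (maxn n m) (leq_maxr _ _); rewrite /= rnormE ltcR => st.
have := uh n (maxn n m) (leq_maxl _ _).
have := rnormD (s - u (maxn n m)) (u (maxn n m) - u n).
by rewrite addrA subrK; lra.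
Qed.

End GeometricSequences.

Section SquareRoot.
Context (R : realType) (A : cstarAlgType R).
Implicit Types (a b s x y : A).

Lemma cmul_subr_sq s t :
  cmul s s - cmul t t = cmul s (s - t) + cmul (s - t) t :> A.
Proof. by rewrite cmulBl cmulBr addrA subrK. Qed.

Lemma rnorm_subr_sq s t : rnorm (cmul s s - cmul t t) <=
  (rnorm s + rnorm t) * rnorm (s - t).
Proof.
rewrite cmul_subr_sq mulrDl (le_trans (rnormD _ _))// lerD ?rnormM//.
by rewrite mulrC rnormM.
Qed.

(** The element [1 - s] of the unitization is a square root of [1 - x]; working
    with [s] keeps the statement inside a possibly non-unital algebra.  The
    equation [s + s - s s = x] says that [s] is a fixed point of
    [T s = (x + s s) / 2], which contracts the ball of radius |x| by the factor
    |x|.  The iterates from 0 are self-adjoint and commute with everything that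
    commutes with [x], and these properties pass to the limit. *)
Lemma sqrt_one_sub x : cstar x = x -> rnorm x < 1 ->
  exists s, [/\ cstar s = s, s + s - cmul s s = x &
    forall a, cmul a x = cmul x a -> cmul a s = cmul s a].
Proof.
move=> xs x1; set q := rnorm x in x1.
have q0 : 0 <= q by exact: rnorm_ge0.
have q01 : 0 <= q < 1 by rewrite q0.
pose h : R[i] := (2^-1)%:C%C.
have hn y : rnorm (h *: y) = 2^-1 * rnorm y.
  by rewrite rnormZr ger0_norm.
have hD y : h *: y + h *: y = y.
  rewrite -scalerDl -rmorphD (_ : 2^-1 + 2^-1 = 1 :> R) ?rmorph1 ?scale1r//.
  by field.
pose T s := h *: (x + cmul s s).
pose u n := iter n T 0.
have uq n : rnorm (u n) <= q.
  elim: n => [|n IH]; first by rewrite rnorm0.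
  have u0 := rnorm_ge0 (u n).
  have uu : rnorm (u n) * rnorm (u n) <= q * 1 by rewrite ler_pM// ltW// (le_lt_trans IH).
  rewrite /= hn; have := rnormD x (cmul (u n) (u n)).
  have := rnormM (u n) (u n); rewrite -/q; lra.
have dT s t : rnorm (T s - T t) <= 2^-1 * ((rnorm s + rnorm t) * rnorm (s - t)).
  rewrite /T -scalerBr opprD addrACA subrr add0r hn.
  by rewrite ler_pM2l ?invr_gt0// rnorm_subr_sq.
have uS n : rnorm (u n.+1 - u n) <= q ^+ n.
  elim: n => [|n IH].
    by rewrite subr0 expr0 (le_trans (uq 1%N))// ltW.
  rewrite exprS (le_trans (dT _ _))//.
  apply: (@le_trans _ _ (q * rnorm (u n.+1 - u n))); last exact: ler_wpM2l.
  rewrite mulrA ler_wpM2r ?rnorm_ge0//.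
  have := uq n; have := uq n.+1; lra.
(* K is the sum of the geometric series of ratio q, so the tail after n steps
   is K q^n. *)
pose K := (1 - q)^-1.
have K0 : 0 <= K by rewrite invr_ge0 subr_ge0 ltW.
have Kq n : K * q ^+ n - K * q ^+ n.+1 = q ^+ n.
  rewrite exprS mulrCA mulrA -mulrBl (_ : K - q * K = 1) ?mul1r//.
  by rewrite -{1}(mul1r K) -mulrBl mulfV// gt_eqF// subr_gt0.
have [|s us] := @rnorm_geometric_cvg R A q K u q01.
  move=> n m; suff : rnorm (u (n + m)%N - u n) <= K * q ^+ n - K * q ^+ (n + m).
    by move/le_trans; apply; rewrite gerBl mulr_ge0// exprn_ge0.
  elim: m => [|m IH]; first by rewrite addn0 !subrr rnorm0.
  have := rnormD (u (n + m).+1 - u (n + m)%N) (u (n + m)%N - u n).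
  rewrite addnS addrA subrK; have := Kq (n + m)%N; have := uS (n + m)%N; lra.
have ustar n : cstar (u n) = u n.
  elim: n => [|n IH]; first exact: cstar0.
  rewrite /= /T cstarZ cstarD cstarM IH xs; congr (_ *: _).
  by rewrite /h /= oppr0.
have ucomm a n : cmul a x = cmul x a -> cmul a (u n) = cmul (u n) a.
  move=> ax; elim: n => [|n IH]; first by rewrite /= cmulx0 cmul0x.
  by rewrite /= /T cmulZr cmulZl cmulDr cmulDl ax cmulA IH -cmulA IH cmulA.
exists s; split=> [||a ax].
- apply/eqP; rewrite -subr_eq0; apply/eqP.
  apply: (rnorm_geometric_eq0 (K := K + K) q01) => n.
  have -> : cstar s - s = cstar (s - u n) - (s - u n).
    by rewrite cstarB ustar opprB addrA subrK.
  rewrite (le_trans (rnormD _ _))// rnormN rnorm_star.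
  by rewrite mulrDl lerD.
- suff sT : s = T s.
    by rewrite {1 2}sT hD addrK.
  apply/eqP; rewrite -subr_eq0; apply/eqP.
  apply: (rnorm_geometric_eq0 (K := K * q + 2^-1 * ((rnorm s + q) * K)) q01) => n.
  have -> : s - T s = (s - u n.+1) - (T s - T (u n)).
    by rewrite opprB addrA subrK.
  rewrite (le_trans (rnormD _ _))// rnormN mulrDl lerD//.
    by rewrite -mulrA -exprS.
  rewrite (le_trans (dT _ _))// -!mulrA ler_pM2l ?invr_gt0//.
  by rewrite ler_pM ?addr_ge0 ?rnorm_ge0// lerD2l.
- apply/eqP; rewrite -subr_eq0; apply/eqP.
  apply: (rnorm_geometric_eq0 (K := rnorm a * K + K * rnorm a) q01) => n.
  have -> : cmul a s - cmul s a = cmul a (s - u n) - cmul (s - u n) a.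
    by rewrite cmulBr cmulBl ucomm// opprB addrA subrK.
  rewrite (le_trans (rnormD _ _))// rnormN mulrDl lerD//.
    by rewrite (le_trans (rnormM _ _))// -mulrA ler_wpM2l ?rnorm_ge0.
  rewrite (le_trans (rnormM _ _))// mulrAC ler_wpM2r ?rnorm_ge0//.
Qed.

End SquareRoot.

(** * Contractivity of *-homomorphisms *)

Section Contractive.
Context (R : realType).
Implicit Types (A B Q : cstarAlgType R).

(** Under these identities [p + i q] and [p - i q] both have the norm of [y] by
    the C*-identity, and [p] is half their sum.  This replaces the positivity
    of [q* q], whose usual proof needs the functional calculus. *)
Lemma rnorm_le_of_sum_sq A (y p q : A) :
  cmul (cstar p) p + cmul (cstar q) q = cmul (cstar y) y ->
  cmul (cstar p) q = cmul (cstar q) p -> rnorm p <= rnorm y.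
Proof.
move=> pqy pq.
have rot (c : R[i]) : conjc c = - c -> c * c = -1 -> rnorm (p + c *: q) = rnorm y.
  move=> cc c2; apply/eqP; rewrite -(eqrXn2 (n := 2)) ?rnorm_ge0//.
  rewrite -!rnorm_cstar -pqy cstarD cstarZ cc cmulDl !cmulDr !cmulZl !cmulZr.
  by rewrite scalerA mulNr c2 opprK scale1r pq scaleNr addrA addrK.
have ic : conjc 'i%C = - 'i%C :> R[i] by simpc.
have i2 : 'i%C * 'i%C = -1 :> R[i] by rewrite -expr2 sqr_i.
have p1 := rot ('i)%C ic i2.
have p2 : rnorm (p - 'i%C *: q) = rnorm y.
  by rewrite -scaleNr; apply: rot; [rewrite -ic conjcK ic opprK|rewrite mulrNN].
have := rnormD (p + 'i%C *: q) (p - 'i%C *: q).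
rewrite addrACA subrr addr0 p1 p2 -mulr2n -scaler_nat rnormZ.
have -> : (2%:R : R[i]) = (2%:R)%:C%C by rewrite rmorph_nat.
rewrite -rnormZ rnormZr ger0_norm//; lra.
Qed.

(** With [b = f a] and [1 - r] the image of the square root of [1 - a a], one
    has b^2 + (1 - r)^2 = 1, and [b] and [r] commute.  Applying this to
    the vector [b] gives |b b| <= |b|, that is |b|^2 <= |b|. *)
Lemma star_hom_le1 A B (f : A -> B) a : star_hom f ->
  cstar a = a -> rnorm a < 1 -> rnorm (f a) <= 1.
Proof.
move=> fh as_ a1.
have a2s : cstar (cmul a a) = cmul a a by rewrite cstarM as_.
have a2 : rnorm (cmul a a) < 1.
  by rewrite (le_lt_trans (rnormM _ _))// -expr2 expr_lt1// rnorm_ge0.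
have [s [ss s2 sa]] := sqrt_one_sub a2s a2.
set b := f a; pose r := f s.
have bs : cstar b = b by rewrite -(star_homS fh) as_.
have rs : cstar r = r by rewrite -(star_homS fh) ss.
have b2 : cmul b b = r + r - cmul r r.
  by rewrite -!(star_homM fh) -s2 (star_homB fh) (star_homD fh).
have br : cmul b r = cmul r b.
  by rewrite -!(star_homM fh) sa// cmulA.
have bb : rnorm (cmul b b) <= rnorm b.
  apply: (@rnorm_le_of_sum_sq B b _ (b - cmul r b)).
    rewrite cstarB !cstarM bs rs -cmulA (cmulA b b b) {1}b2.
    rewrite cmulBl cmulDl cmulBr cmulDr cmulBl !cmulBr -!cmulA.
    set X := cmul b b; set Y := cmul b (cmul r b); set Z := cmul b _.
    have -> : X - Y - (Y - Z) = X - (Y + Y - Z).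
      by rewrite !opprB addrACA opprD !addrA.
    by rewrite addrC subrK.
  rewrite cstarB !cstarM bs rs cmulBl cmulBr -!cmulA; congr (_ - cmul b _).
  by rewrite !cmulA br.
have [->//|b0] := eqVneq (rnorm b) 0.
have bp : 0 < rnorm b by rewrite lt_neqAle eq_sym b0 rnorm_ge0.
by rewrite -(ler_pM2r bp) mul1r -expr2 -rnorm_cstar bs.
Qed.

Theorem star_hom_contractive A B (f : A -> B) a : star_hom f ->
  rnorm (f a) <= rnorm a.
Proof.
move=> fh.
have sa x : cstar x = x -> rnorm (f x) <= rnorm x.
  move=> xs; apply/ler_addgt0Pr => e e0; set t := rnorm x + e.
  have t0 : 0 < t by rewrite ltr_wpDl ?rnorm_ge0.
  have : rnorm (f (t^-1%:C%C *: x)) <= 1.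
    apply: star_hom_le1 => //; first by rewrite cstarZ xs; congr (_ *: _); rewrite /= oppr0.
    by rewrite rnormZr gtr0_norm ?invr_gt0// mulrC ltr_pdivrMr// mul1r ltrDl.
  by rewrite (star_homZ fh) rnormZr gtr0_norm ?invr_gt0// mulrC ler_pdivrMr// mul1r.
rewrite -(@ler_pXn2r _ 2) ?nnegrE ?rnorm_ge0// -!rnorm_cstar.
by rewrite -(star_homS fh) -(star_homM fh) sa// cstarM cstarK.
Qed.

(** [q] descends to a *-homomorphism on [Q] through the surjection [p]; stated
    on [A] so that the induced map need not be constructed by its users. *)
Corollary star_hom_factor_contractive A Q B (p : A -> Q) (q : A -> B) a :
  star_hom p -> star_hom q -> (forall y, exists x, p x = y) ->
  (forall x x', p x = p x' -> q x = q x') -> rnorm (q a) <= rnorm (p a).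
Proof.
move=> ph qh /choice[s sK] pq.
have gE x : q (s (p x)) = q x by apply: pq; rewrite sK.
rewrite -gE; apply: (@star_hom_contractive Q B (q \o s)).
split=> [c x y|x y|x] /=.
- by rewrite -(star_homZ qh) -(star_homD qh); apply: pq; rewrite (star_homD ph) (star_homZ ph) !sK.
- by rewrite -(star_homM qh); apply: pq; rewrite (star_homM ph) !sK.
- by rewrite -(star_homS qh); apply: pq; rewrite (star_homS ph) !sK.
Qed.

End Contractive.

(** * Extension of bundle homomorphisms *)

Lemma cvg_near_pt (R : realType) (I J : metricType R) (al : I -> J) j :
  dense_isometric_embedding al -> al i @[i --> near_pt al j] --> j.
Proof.
move=> hal; have GF := near_pt_filter j hal.
apply/cvg_ballP => e e0; exists e => //= i ji.
by rewrite ballEmdist.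
Qed.

Section BundleHomExtension.
Context (R : realType) (I J : metricType R) (A : ucbBundle I) (B : ucbBundle J).
Context (al : I -> J) (be : sections A -> sections B).
Hypothesis hom_be : bundle_hom al be.

Lemma fnorm_hom_le a i : fnorm (be a) (al i) <= fnorm a i.
Proof.
have [_ bh evb] := hom_be.
apply: (@star_hom_factor_contractive _ _ _ _ (ev i) (fun a => ev (al i) (be a))).
- exact: ev_star_hom.
- have eh := ev_star_hom B (al i).
  split=> [c x y|x y|x].
  + by rewrite (star_homD bh) (star_homZ bh) (star_homD eh) (star_homZ eh).
  + by rewrite (star_homM bh) (star_homM eh).
  + by rewrite (star_homS bh) (star_homS eh).
- exact: ev_surj.
- exact: evb.
Qed.

Context (I' J' : metricType R) (iI : I -> I') (iJ : J -> J') (c : I' -> J').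
Hypotheses (hI : dense_isometric_embedding iI) (hJ : dense_isometric_embedding iJ).
Hypotheses (c_cont : continuous c) (cE : forall i, c (iI i) = iJ (al i)).

Lemma near_pt_hom j : al i @[i --> near_pt iI j] `=>` near_pt iJ (c j).
Proof.
have GF := near_pt_filter j hI.
move=> S [e e0 eS].
have : c (iI i) @[i --> near_pt iI j] --> c j.
  by apply: (@cvg_comp _ _ _ iI c _ (nbhs j)); [exact: cvg_near_pt|exact: c_cont].
move=> /cvg_ballP/(_ _ e0); apply: filterS => i.
by rewrite ballEmdist /= cE => /eS.
Qed.

(** [cnrm] is the limit of the fibre norms at nearby points of the original base,
    and [al] maps points near [j] to points near [c j]. *)
Lemma cnrm_hom_le j a : cnrm iJ (c j) (be a) <= cnrm iI j a.
Proof.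
have GF := near_pt_filter j hI.
have Ka := @fnorm_cvg _ _ _ _ _ hI j a.
have Kb : fnorm (be a) (al i) @[i --> near_pt iI j] --> cnrm iJ (c j) (be a).
  apply: (@cvg_comp _ _ _ al (fnorm (be a)) _ (near_pt iJ (c j))).
    exact: near_pt_hom.
  exact: fnorm_cvg.
by refine (ler_cvg_to Kb Ka (nearW _ _)); exact: fnorm_hom_le.
Qed.

(** The non-strict inequality of distances holds on a dense subset and both of
    its sides are continuous. *)
Lemma metric_map_extension : metric_map c.
Proof.
have [mal _ _] := hom_be.
have app x e : 0 < e -> exists i, mdist x (iI i) < e /\ mdist (c x) (c (iI i)) < e.
  move=> e0; have GF := near_pt_filter x hI.
  have n1 := cvg_near_pt (j := x) hI.
  have n2 : c (iI i) @[i --> near_pt iI x] --> c x.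
    by apply: (@cvg_comp _ _ _ iI c _ (nbhs x)); [exact: n1|exact: c_cont].
  move/cvg_ballP/(_ _ e0) : n1; move/cvg_ballP/(_ _ e0) : n2.
  by move=> n1 n2; have [i []] := filter_ex (filterI n1 n2); rewrite !ballEmdist; exists i.
move=> x y; apply/ler_addgt0Pr => e e0.
have e40 : 0 < e / 4 by rewrite divr_gt0.
have [i [xi cxi]] := app x _ e40; have [k [yk cyk]] := app y _ e40.
have ik : mdist (c (iI i)) (c (iI k)) <= mdist (iI i) (iI k).
  by rewrite !cE hI.1 hJ.1.
have := metric_triangle (c x) (c (iI i)) (c y).
have := metric_triangle (c (iI i)) (c (iI k)) (c y).
have := metric_triangle (iI i) x (iI k).
have := metric_triangle x y (iI k).
rewrite (metric_sym (iI i) x) (metric_sym (c (iI k)) (c y)); lra.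
Qed.

(** A difference of two sections that lies in the ideal at [j] has [cnrm] 0
    there, so its image has [cnrm] 0 at [c j] and lies in the ideal at [c j]. *)
Theorem minimal_extension_hom :
  bundle_hom (A := minimal_extension A hI) (B := minimal_extension B hJ) c be.
Proof.
have [_ bh _] := hom_be; split=> // [|j a1 a2]; first exact: metric_map_extension.
move=> /ideal_piP K12; apply/ideal_piP.
rewrite -(star_homB bh); apply: cnrm_eq0 => //; apply/eqP.
rewrite eq_le -{2}(@quot_rnormE _ _ _ B iJ hJ) rnorm_ge0 andbT.
apply: le_trans (cnrm_hom_le _ _) _.
have GF := near_pt_filter j hI.
have /(@extension_ideal_cvg _ _ _ _ _ _ hI) K0 := K12.
by rewrite (cvg_unique (@Rhausdorff R) (@fnorm_cvg _ _ _ _ _ hI j (a1 - a2)) K0).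
Qed.

End BundleHomExtension.

Lemma continuous_fixing_dense (R : realType) (I J : metricType R) (al : I -> J)
    (c : J -> J) : dense_isometric_embedding al -> continuous c ->
  (forall i, c (al i) = al i) -> c = id.
Proof.
move=> hal cc cE; apply/funext => x; apply/esym.
have GF := near_pt_filter x hal.
apply: (cvg_unique (@metric_hausdorff R J) (cvg_near_pt (j := x) hal)).
rewrite -[X in X @ _](_ : c \o al = al).
  by apply: (@cvg_comp _ _ _ al c _ (nbhs x)); [exact: cvg_near_pt|exact: cc].
by apply/funext => i /=; rewrite cE.
Qed.

(** * Extension of flows *)

Section FlowExtension.
Context (R : realType) (I J : metricType R) (A : ucbBundle I) (al : I -> J).
Hypothesis hal : dense_isometric_embedding al.

(** The time-[t] map respects the fibre at [h] because it covers an automorphism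
    of that fibre. *)
Lemma flow_bundle_hom (tau : R -> sections A -> sections A) t :
  is_dynamical A tau -> bundle_hom (A := A) (B := A) id (tau t).
Proof.
move=> [[ta _ _] th]; split=> [x y //||h a1 a2 a12]; first by case: (ta t).
by have [tauh _ tE] := th h t; rewrite -!tE a12.
Qed.

(** The extended time-[t] maps descend to endomorphisms of the new fibres, and
    the group law of the flow makes those for [t] and [- t] mutually inverse. *)
Lemma minimal_extension_dynamical (tau : R -> sections A -> sections A) :
  is_dynamical A tau -> is_dynamical (minimal_extension A hal) tau.
Proof.
move=> dtau; have [[ta t0 tD] _] := dtau.
split=> // j t.
have ext s a1 a2 : quot_ev hal j a1 = quot_ev hal j a2 ->
    quot_ev hal j (tau s a1) = quot_ev hal j (tau s a2).
  have hs := flow_bundle_hom s dtau.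
  have cid : continuous (@id J) by move=> x; exact: cvg_id.
  by have [_ _] := minimal_extension_hom hs hal hal cid (fun=> erefl); exact.
pose g s (x : quot_fibre A hal j) := quot_ev hal j (tau s (ideal_repr x)).
have gE s a : g s (quot_ev hal j a) = quot_ev hal j (tau s a).
  by apply: ext; exact: ideal_reprK.
have gK s : cancel (g s) (g (- s)).
  by move=> x; have [a <-] := quot_ev_surj x; rewrite !gE -tD addNr t0.
exists (g t); last exact: gE.
split; last first.
  by exists (g (- t)); [exact: gK|have := gK (- t); rewrite opprK].
have qh := quot_ev_star_hom A hal j; have [th _] := ta t.
split=> [k x y|x y|x]; have [a <-] := quot_ev_surj x.
- have [b <-] := quot_ev_surj y.
  rewrite -(star_homZ qh) -(star_homD qh) !gE.
  by rewrite (star_homD th) (star_homZ th) (star_homD qh) (star_homZ qh).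
- have [b <-] := quot_ev_surj y.
  by rewrite -(star_homM qh) !gE (star_homM th) (star_homM qh).
- by rewrite -(star_homS qh) !gE (star_homS th) (star_homS qh).
Qed.

End FlowExtension.

(** * Functoriality *)

Theorem proposition5p3 (R : realType)
    (coll : metricType R -> Prop)
    (C : metricType R -> metricType R)
    (alpha : forall I : metricType R, I -> C I)
    (Cmap : forall I J : metricType R, (I -> J) -> C I -> C J)
    (coll_nonempty : exists I, coll I)
    (coll_lc : forall I, coll I -> locally_compact [set: I])
    (C_lc : forall I, coll I -> locally_compact [set: C I])
    (halpha : forall I, coll I -> dense_isometric_embedding (alpha I))
    (Cfun : functorial_assignment coll C alpha Cmap)
    (* C(f) is a morphism of base spaces, as the target category requires *)
    (Cproper : forall (I J : metricType R) (f : I -> J), coll I -> coll J ->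
       metric_map f -> proper_map f -> proper_map (Cmap I J f)) :
  exists (F_dynamical : forall X : dynBundle coll,
            is_dynamical (F_bundle halpha X) (flow X))
         (F_dynHom : forall (X Y : dynBundle coll) (s : dynHom X Y),
            is_dynHom (FD_obj F_dynamical X) (FD_obj F_dynamical Y)
              (Cmap (base X) (base Y) (hom_base s)) (hom_sections s)),
  is_functor (DBun coll) (DBun (Ccoll C coll))
    (FD_obj F_dynamical) (FD_hom F_dynHom).
Proof.
have [Cext Ccomp] := Cfun.
have Fd (X : dynBundle coll) : is_dynamical (F_bundle halpha X) (flow X).
  by apply: minimal_extension_dynamical; exact: flow_dynamical.
exists Fd.
have Fh (X Y : dynBundle coll) (s : dynHom X Y) :
    is_dynHom (FD_obj Fd X) (FD_obj Fd Y)
      (Cmap (base X) (base Y) (hom_base s)) (hom_sections s).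
  have [hs ps fs] := hom_is_dynHom s; have [ms _ _] := hs.
  have [Cc CE] := Cext _ _ _ (base_coll X) (base_coll Y) ms ps.
  split; [exact: (minimal_extension_hom hs _ _ Cc CE)|exact: Cproper (base_coll X) (base_coll Y) ms ps|exact: fs].
exists Fh; split=> [X|X Y Z u s]; apply: dynHom_eq => //=.
  have cX := base_coll X.
  have [[idm _ _] idp _] := hom_is_dynHom (dynHom_id X).
  have [Cc CE] := Cext _ _ _ cX cX idm idp.
  exact: continuous_fixing_dense (halpha _ cX) Cc CE.
have [[mu _ _] pu _] := hom_is_dynHom u; have [[ms _ _] ps _] := hom_is_dynHom s.
by apply/funext => x; apply: Ccomp => //; exact: base_coll.
Qed.
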